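(* Let $X$ and $Y$ be Banach spaces such that given $\varepsilon\in(0,1)$, there is some $\eta=\eta(\varepsilon)\in(0,1)$ such that for every monomorphism $T\in\mathcal{BL}(X,Y)$, the pair $(T(X),X)$ has the Bishop-Phelps-Bollobás property with $\eta$ (that is, with this same function $\eta$, independent of $T$). Then $(X,Y)$ has the bounded BPBp-$m$.
   Context: Banach spaces are over $\mathbb{K}=\mathbb{R}$ or $\mathbb{C}$ and are nonzero. $\mathcal{L}(X,Y)$ is the space of bounded linear operators from $X$ to $Y$ with the operator norm; $S_X$ is the unit sphere of $X$. For $T\in\mathcal{L}(X,Y)$, $m(T):=\inf\{\|T(x)\|: x\in S_X\}$. $\mathcal{BL}(X,Y)$ is the set of bounded below operators (monomorphisms), i.e. those $T\in\mathcal{L}(X,Y)$ with $m(T)>0$; for such $T$ the range $T(X)$ is a closed subspace of $Y$, endowed with the norm of $Y$. A pair of Banach spaces $(Z,W)$ has the Bishop-Phelps-Bollobás property (BPBp) with the function $\varepsilon\mapsto\eta(\varepsilon)>0$ if for every given $\varepsilon$, whenever $T\in\mathcal{L}(Z,W)$ with $\|T\|=1$ and $x\in S_Z$ satisfy $\|T(x)\|>1-\eta(\varepsilon)$, there exist $S\in\mathcal{L}(Z,W)$ with $\|S\|=1$ and $y\in S_Z$ such that $\|S(y)\|=1$, $\|S-T\|<\varepsilon$, and $\|x-y\|<\varepsilon$. A pair of Banach spaces $(X,Y)$ has the bounded Bishop-Phelps-Bollobás property for the minimum norm (bounded BPBp-$m$) if given $\varepsilon>0$ and $0\leq\rho\leq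 R$ there exists some $\eta(\varepsilon,R,\rho)\in(0,1)$ (converging to $0$ as $\varepsilon\to0$) such that whenever $x\in S_X$ and $T\in\mathcal{L}(X,Y)$ with $\|T\|\leq R$ and $m(T)=\rho$ satisfy $\|T(x)\|<m(T)(1+\eta(\varepsilon,R,\rho))$ if $\rho>0$, or $\|T(x)\|<\eta(\varepsilon,R,\rho)$ if $\rho=0$, there exist $S\in\mathcal{L}(X,Y)$ and $y\in S_X$ such that $\|S(y)\|=m(S)=m(T)=\rho$, $\|T-S\|<\varepsilon$, and $\|x-y\|<\varepsilon$. *)

(* Defs.v *)
From HB Require Import structures.
From mathcomp Require Import all_boot all_order all_algebra.
From mathcomp Require Import complex.
From mathcomp Require Import all_classical all_reals all_analysis.

Set Implicit Arguments.
Unset Strict Implicit.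
Unset Printing Implicit Defensive.
Import Order.TTheory GRing.Theory Num.Theory.
Import numFieldNormedType.Exports.

Local Open Scope classical_set_scope.
Local Open Scope ring_scope.

(* The scalar field is either the realType R or its complexification R[i]. *)
Inductive scalars := RealScalars | ComplexScalars.

Definition scal (R : realType) (k : scalars) : numFieldType :=
  match k with
  | RealScalars => R : numFieldType
  | ComplexScalars => R[i] : numFieldType
  end.

(* MathComp norms take values in the scalar field: in the complex case `|x|
   is a complex number with zero imaginary part, whence the projection. *)
Definition scal_re (R : realType) (k : scalars) : scal R k -> R :=
  match k return scal R k -> R with
  | RealScalars => id
  | ComplexScalars => @complex.Re R
  end.

Definition nrm (R : realType) (k : scalars) (V : normedModType (scal R k))
  (x : V) : R := scal_re `|x|.

Definition sphere (R : realType) (k : scalars) (V : normedModType (scal R k)) :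
  set V := [set x | nrm x = 1].
Arguments sphere {R k} V.

(* sup and inf take junk values on sets without bounds, but below they are
   applied to bounded operators on nonzero spaces only. *)
Definition opnorm (R : realType) (k : scalars) (X Y : normedModType (scal R k))
  (f : X -> Y) : R := sup [set nrm (f x) | x in sphere X].

Definition minnorm (R : realType) (k : scalars) (X Y : normedModType (scal R k))
  (f : X -> Y) : R := inf [set nrm (f x) | x in sphere X].

Record bounded_op (R : realType) (k : scalars) (X Y : normedModType (scal R k))
  := BoundedOp {
  op_fun :> {linear X -> Y};
  op_cont : continuous op_fun }.

(* Bounded below operators: the set BL(X, Y). *)
Record monomorphism (R : realType) (k : scalars)
    (X Y : normedModType (scal R k)) := Monomorphism {
  mono_op :> bounded_op X Y;
  mono_gt0 : 0 < minnorm mono_op }.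

Section monomorphism_bounded_below.
Context (R : realType) (k : scalars).

Let scal_of : R -> scal R k :=
  match k return R -> scal R k with
  | RealScalars => id
  | ComplexScalars => fun r => r%:C%C
  end.

Let ler_scal_of x y : x <= y -> scal_of x <= scal_of y.
Proof. by rewrite /scal_of; case: k => // xy; rewrite lecR. Qed.

Let ltr_scal_of x y : x < y -> scal_of x < scal_of y.
Proof. by rewrite /scal_of; case: k => // xy; rewrite ltcR. Qed.

Let scal_of0 : scal_of 0 = 0.
Proof. by rewrite /scal_of; case: k. Qed.

Let scal_reK (z : scal R k) : 0 <= z -> scal_of (scal_re z) = z.
Proof.
by move/ger0_real; rewrite /scal_of; case: k z => //= z; exact: RRe_real.
Qed.

Let scal_re_ge0 (z : scal R k) : 0 <= z -> 0 <= scal_re z.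
Proof.
by rewrite /scal_re; case: k z => //= z; rewrite lecE => /andP[].
Qed.

Let scal_re1 : scal_re (1 : scal R k) = 1.
Proof. by rewrite /scal_re; case: k. Qed.

Context (X Y : normedModType (scal R k)) (T : monomorphism X Y).

Lemma monomorphism_lower_bound :
  exists2 c : scal R k, 0 < c & forall x, c * `|x| <= `|T x|.
Proof.
exists (scal_of (minnorm T)).
  by rewrite -scal_of0; exact/ltr_scal_of/mono_gt0.
move=> x; have [->|x0] := eqVneq x 0; first by rewrite normr0 mulr0.
have nx0 : 0 < `|x| by rewrite normr_gt0.
rewrite -ler_pdivlMr//.
have -> : `|T x| / `|x| = `|T (`|x|^-1 *: x)|.
  by rewrite linearZ/= normrZ ger0_norm ?invr_ge0// mulrC.
rewrite -[leRHS]scal_reK//; apply: ler_scal_of; apply: ge_inf.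
  by exists 0 => _ [y _ <-]; exact: scal_re_ge0.
exists (`|x|^-1 *: x) => //.
by rewrite /sphere/= /nrm normrZ ger0_norm ?invr_ge0// mulVf ?gt_eqF.
Qed.

End monomorphism_bounded_below.

Section range_space.
Context (R : realType) (k : scalars) (X : completeNormedModType (scal R k)).
Context (Y : normedModType (scal R k)) (T : monomorphism X Y).

Definition range_pred : {pred Y} := fun y => y \in range T.

Let range_pred_submod : submod_closed range_pred.
Proof.
split; first by rewrite unfold_in inE; exists 0; rewrite ?linear0.
move=> a _ _ /[!unfold_in] /[!inE] -[x _ <-] [y _ <-].
by exists (a *: x + y) => //; rewrite linearP.
Qed.

HB.instance Definition _ :=
  GRing.isSubmodClosed.Build (scal R k) Y range_pred range_pred_submod.

Record range_space := RangeSpace {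
  range_val :> Y;
  _ : range_val \in range_pred }.

HB.instance Definition _ := [isSub for range_val].
HB.instance Definition _ := [Choice of range_space by <:].
HB.instance Definition _ := [SubChoice_isSubLmodule of range_space by <:].

Let range_norm (z : range_space) : scal R k := `|range_val z|.

Let range_normD z w : range_norm (z + w) <= range_norm z + range_norm w.
Proof. exact: ler_normD. Qed.

Let range_normZ a z : range_norm (a *: z) = `|a| * range_norm z.
Proof. exact: normrZ. Qed.

Let range_norm_eq0 z : range_norm z = 0 -> z = 0.
Proof. by move=> /normr0_eq0 z0; exact/val_inj. Qed.

HB.instance Definition _ := Lmodule_isNormed.Build (scal R k) range_space
  range_normD range_normZ range_norm_eq0.

Lemma range_space_normE (z : range_space) : `|z| = `|range_val z|.
Proof. by []. Qed.

Let range_complete (F : set_system range_space) :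
  ProperFilter F -> cauchy F -> cvg F.
Proof.
move=> FF /cauchy_ballP cF.
have [c c0 cT] := monomorphism_lower_bound T.
have surj (z : range_space) : {x | T x = range_val z}.
  apply: cid; case: z => y /= /[!unfold_in] /[!inE] -[x _ <-].
  by exists x.
pose f z := sval (surj z).
have fP z : T (f z) = range_val z by rewrite /f; case: (surj z).
have cfF : cauchy (f @ F).
  apply/cauchy_ballP => e e0; have ce0 : 0 < c * e by rewrite mulr_gt0.
  have := cF _ ce0; rewrite !near_simpl => -[[A B] [FA FB] AB].
  exists (f @` A, f @` B) => /=.
    by split; [apply: filterS FA|apply: filterS FB] => z; exists z.
  move=> [_ _] /= [[z Az <-] [w Bw <-]].
  have := AB (z, w) (conj Az Bw); rewrite -!ball_normE /= => zw.
  rewrite -(ltr_pM2l c0); apply: le_lt_trans (cT _) _.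
  by rewrite linearB /= !fP.
have /cvg_ex[x fx] : cvg (f @ F) by exact: cauchy_cvg.
have Tx : T x \in range_pred by rewrite unfold_in inE; exists x.
apply/cvg_ex; exists (RangeSpace Tx); apply/cvgrPdist_lt => e e0.
have /cvgrPdist_lt/(_ _ e0) : T @ (f @ F) --> T x.
  exact: cvg_trans (cvg_app _ fx) (@op_cont _ _ _ _ T x).
rewrite !near_simpl; apply: filterS => z /=.
by rewrite range_space_normE /= fP.
Qed.

HB.instance Definition _ := Uniform_isComplete.Build range_space range_complete.

End range_space.

(* The modulus eta is a function on ]0, 1[, extended arbitrarily to R. *)
Definition BPBp (R : realType) (k : scalars)
    (Z W : completeNormedModType (scal R k)) (eta : R -> R) : Prop :=
  forall eps : R, 0 < eps < 1 ->
    0 < eta eps /\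
    forall (T : bounded_op Z W) (x : Z), opnorm T = 1 -> x \in sphere Z ->
      nrm (T x) > 1 - eta eps ->
      exists (S : bounded_op Z W) (y : Z),
        [/\ opnorm S = 1, y \in sphere Z, nrm (S y) = 1,
            opnorm (S \- T) < eps & nrm (x - y) < eps].

Definition bounded_BPBp_m (R : realType) (k : scalars)
    (X Y : completeNormedModType (scal R k)) : Prop :=
  exists eta : R -> R -> R -> R, forall M rho : R, 0 <= rho <= M ->
    eta eps M rho @[eps --> 0^'+] --> 0 /\
    forall eps : R, 0 < eps ->
      0 < eta eps M rho < 1 /\
      forall (T : bounded_op X Y) (x : X),
        x \in sphere X -> opnorm T <= M -> minnorm T = rho ->
        (0 < rho -> nrm (T x) < minnorm T * (1 + eta eps M rho)) ->
        (rho = 0 -> nrm (T x) < eta eps M rho) ->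
        exists (S : bounded_op X Y) (y : X),
          [/\ y \in sphere X, nrm (S y) = minnorm S, minnorm S = minnorm T,
              opnorm (T \- S) < eps & nrm (x - y) < eps].

(* Main.v *)
(* Suppose rho = m(T) > 0. Then U = rho T^-1 : T(X) -> X has norm one and almost
   attains its norm at T x / |T x|, so the hypothesis yields a norm-attaining V
   of norm one near U. Being close to an isomorphism, V is invertible, and
   S = rho V^-1 has minimum norm rho / |V| = rho, attained at V w when V attains
   its norm at w. If rho = 0, a norm-one functional f with f x = 1 gives the
   operator S = T - f(.) T x, which vanishes at x. *)
Require Import Defs.
From HB Require Import structures.
From mathcomp Require Import all_boot all_order all_algebra.
From mathcomp Require Import complex ring lra.
From mathcomp Require Import all_classical all_reals all_analysis.

Set Implicit Arguments.
Unset Strict Implicit.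
Unset Printing Implicit Defensive.
Import Order.TTheory GRing.Theory Num.Theory.
Import numFieldNormedType.Exports.

Local Open Scope classical_set_scope.
Local Open Scope ring_scope.

(** * Embedding of the real numbers into the scalar field *)

Section real_scalars.
Context (R : realType) (k : scalars).

(** Library norms are scalar-valued. This section of [scal_re] transports their order and algebra to
    the real-valued [nrm]. *)
Definition rscal : R -> scal R k :=
  match k return R -> scal R k with
  | RealScalars => id
  | ComplexScalars => fun r => r%:C%C
  end.

Lemma rscal0 : rscal 0 = 0. Proof. by rewrite /rscal; case: k. Qed.

Lemma rscal1 : rscal 1 = 1. Proof. by rewrite /rscal; case: k. Qed.

Lemma rscalD x y : rscal (x + y) = rscal x + rscal y.
Proof. by rewrite /rscal; case: k => //; exact: raddfD. Qed.

Lemma rscalN x : rscal (- x) = - rscal x.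
Proof. by rewrite /rscal; case: k => //; exact: raddfN. Qed.

Lemma rscalM x y : rscal (x * y) = rscal x * rscal y.
Proof. by rewrite /rscal; case: k => //; exact: rmorphM. Qed.

Lemma ler_rscal x y : (rscal x <= rscal y) = (x <= y).
Proof. by rewrite /rscal; case: k => //; exact: lecR. Qed.

Lemma ltr_rscal x y : (rscal x < rscal y) = (x < y).
Proof. by rewrite /rscal; case: k => //; exact: ltcR. Qed.

Lemma rscalK : cancel rscal (@scal_re R k).
Proof. by rewrite /rscal; case: k. Qed.

Lemma scal_reK (z : scal R k) : 0 <= z -> rscal (scal_re z) = z.
Proof.
by move/ger0_real; rewrite /rscal; case: k z => //= z; exact: RRe_real.
Qed.

Lemma norm_rscal t : `|rscal t| = rscal `|t|.
Proof.
have [t0|/ltW t0] := leP 0 t.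
  by rewrite !ger0_norm// -rscal0 ler_rscal.
by rewrite !ler0_norm ?rscalN// -rscal0 ler_rscal.
Qed.

End real_scalars.
Arguments rscal {R k}.

(** * The norm as a real number *)

Section real_norm.
Context (R : realType) (k : scalars) (V : normedModType (scal R k)).
Implicit Types x y : V.

Lemma rscal_nrm x : rscal (nrm x) = `|x|.
Proof. exact: scal_reK. Qed.

Lemma nrm_ge0 x : 0 <= nrm x.
Proof. by rewrite -(ler_rscal k) rscal0 rscal_nrm. Qed.

Lemma nrm0 : nrm (0 : V) = 0.
Proof. by rewrite /nrm normr0 -rscal0 rscalK. Qed.

Lemma nrm_eq0 x : (nrm x == 0) = (x == 0).
Proof.
by rewrite -(inj_eq (can_inj (@rscalK R k))) rscal_nrm rscal0 normr_eq0.
Qed.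

Lemma nrm_gt0 x : (0 < nrm x) = (x != 0).
Proof. by rewrite lt_neqAle nrm_ge0 andbT eq_sym nrm_eq0. Qed.

Lemma nrmN x : nrm (- x) = nrm x.
Proof. by rewrite /nrm normrN. Qed.

Lemma nrmB x y : nrm (x - y) = nrm (y - x).
Proof. by rewrite -nrmN opprB. Qed.

Lemma nrmD x y : nrm (x + y) <= nrm x + nrm y.
Proof. by rewrite -(ler_rscal k) rscalD !rscal_nrm ler_normD. Qed.

Lemma nrmZ (t : R) x : nrm (rscal t *: x) = `|t| * nrm x.
Proof.
apply: (can_inj (@rscalK R k)).
by rewrite rscalM !rscal_nrm normrZ norm_rscal.
Qed.

Lemma normed_sphere x : x != 0 -> nrm (rscal (nrm x)^-1 *: x) = 1.
Proof.
move=> x0; rewrite nrmZ ger0_norm ?invr_ge0 ?nrm_ge0//.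
by rewrite mulVf// nrm_eq0.
Qed.

End real_norm.

(** * Operator norm and minimum norm *)

Section operator_norms.
Context (R : realType) (k : scalars) (V W : normedModType (scal R k)).

Lemma linear_nrm_continuous (f : {linear V -> W}) (C : R) :
  (forall x, nrm (f x) <= C * nrm x) -> continuous f.
Proof.
move=> fC; apply: bounded_linear_continuous; apply/linear_boundedP.
exists (rscal C); rewrite realE -rscal0 !ler_rscal.
split; first exact: le_total.
move=> r Cr x; apply: le_trans (_ : rscal C * `|x| <= _).
  by rewrite -!rscal_nrm -rscalM ler_rscal.
by rewrite ler_wpM2r// ltW.
Qed.

Lemma bounded_op_nrm (f : bounded_op V W) :
  exists2 C, 0 <= C & forall x, nrm (f x) <= C * nrm x.
Proof.
have /linear_bounded_continuous/linear_boundedP/pinfty_ex_gt0[r r0 fr] :=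
  @op_cont _ _ _ _ f.
exists (scal_re r).
  by rewrite -(ler_rscal k) rscal0 scal_reK ltW.
move=> x; rewrite -(ler_rscal k) rscalM (scal_reK (ltW r0)) !rscal_nrm.
exact: fr.
Qed.

Lemma bounded_op_of_linear (f : V -> W) (C : R) : linear f ->
  (forall x, nrm (f x) <= C * nrm x) -> exists S : bounded_op V W, S =1 f.
Proof.
move=> lf fC; pose L := GRing.isLinear.Build _ _ _ _ f lf.
by exists (BoundedOp (linear_nrm_continuous
  (f := HB.pack_for {linear V -> W} f L) fC)).
Qed.

(** The crude constant [C] only ensures that the supremum in [opnorm f] is a genuine one.
    Normalising [x] then gives the sharp bound. *)
Lemma nrm_linear_le (f : {linear V -> W}) (C c : R) :
  (forall x, nrm (f x) <= C * nrm x) -> opnorm f <= c ->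
  forall x, nrm (f x) <= c * nrm x.
Proof.
move=> fC fc x; have [->|x0] := eqVneq x 0.
  by rewrite linear0 !nrm0 mulr0.
have xgt0 : 0 < nrm x by rewrite nrm_gt0.
rewrite -ler_pdivrMr// mulrC; apply: le_trans fc.
have -> : (nrm x)^-1 * nrm (f x) = nrm (f (rscal (nrm x)^-1 *: x)).
  by rewrite linearZ nrmZ ger0_norm ?invr_ge0 ?nrm_ge0.
apply: ub_le_sup.
  by exists C => _ [y y1 <-]; rewrite (le_trans (fC y))// y1 mulr1.
by exists (rscal (nrm x)^-1 *: x) => //; exact: normed_sphere.
Qed.

Lemma nrm_bounded_op_le (f : bounded_op V W) (x : V) :
  nrm (f x) <= opnorm f * nrm x.
Proof. by have [C _ fC] := bounded_op_nrm f; exact: nrm_linear_le fC _ x. Qed.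

Lemma nrm_bounded_op_sub_le (f g : bounded_op V W) (c : R) :
  opnorm (f \- g) <= c -> forall x, nrm (f x - g x) <= c * nrm x.
Proof.
have [C _ fC] := bounded_op_nrm f; have [D _ gD] := bounded_op_nrm g.
apply: (@nrm_linear_le (f \- g) (C + D)) => x.
by rewrite mulrDl (le_trans (nrmD _ _))// nrmN lerD.
Qed.

Lemma opnorm_le (f : V -> W) (c : R) : sphere V !=set0 ->
  (forall x, nrm x = 1 -> nrm (f x) <= c) -> opnorm f <= c.
Proof.
move=> [v v1] fc; apply: ge_sup; first by exists (nrm (f v)), v.
by move=> _ [x x1 <-]; exact: fc.
Qed.

Lemma minnorm_le (f : V -> W) (x : V) : nrm x = 1 -> minnorm f <= nrm (f x).
Proof.
move=> x1; apply: ge_inf; last by exists x.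
by exists 0 => _ [y _ <-]; exact: nrm_ge0.
Qed.

Lemma le_minnorm (f : V -> W) (c : R) : sphere V !=set0 ->
  (forall x, nrm x = 1 -> c <= nrm (f x)) -> c <= minnorm f.
Proof.
move=> [v v1] fc; apply: lb_le_inf; first by exists (nrm (f v)), v.
by move=> _ [x x1 <-]; exact: fc.
Qed.

Lemma nrm_ge_minnorm (f : {linear V -> W}) (x : V) :
  minnorm f * nrm x <= nrm (f x).
Proof.
have [->|x0] := eqVneq x 0; first by rewrite linear0 !nrm0 mulr0.
rewrite -ler_pdivlMr ?nrm_gt0// mulrC.
have -> : (nrm x)^-1 * nrm (f x) = nrm (f (rscal (nrm x)^-1 *: x)).
  by rewrite linearZ nrmZ ger0_norm ?invr_ge0 ?nrm_ge0.
exact/minnorm_le/normed_sphere.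
Qed.

End operator_norms.

(** * Surjectivity of operators close to the identity *)

Section near_identity.
Context (R : realType) (k : scalars) (X : completeNormedModType (scal R k)).
Context (A : {linear X -> X}) (q : R).
Hypotheses (q0 : 0 <= q) (q1 : q < 1).
Hypothesis Aq : forall x, nrm (x - A x) <= q * nrm x.

Lemma near_identity_dense (y : X) (e : R) :
  0 < e -> exists x, nrm (y - A x) < e.
Proof.
move=> e0; pose D := [set nrm (y - A x) | x in [set: X]].
have lbD : lbound D 0 by move=> _ [x _ <-]; exact: nrm_ge0.
have D0 : has_inf D by split; [exists (nrm (y - A 0)), 0 | exists 0].
have d0 : 0 <= inf D by apply: lb_le_inf => //; case: D0.
have [d0'|] := ltP 0 (inf D); last first.
  move=> d0'; have {}d0 : inf D = 0 by apply/eqP; rewrite eq_le d0' d0.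
  have [_ [x _ <-]] := inf_adherent e0 D0.
  by rewrite d0 add0r; exists x.
(* This slack is small enough for the contradiction, since [q * (2 - q)] equals [1 - (1 - q) ^+ 2],
   which is below 1. *)
have h : 0 < (1 - q) * inf D by rewrite mulr_gt0// subr_gt0.
have [_ [x _ <-] xd] := inf_adherent h D0.
(* Correcting x by the residual y - A x shrinks the residual by the factor q. *)
have : inf D <= q * nrm (y - A x).
  apply: le_trans (Aq _); apply: ge_inf; first by exists 0.
  by exists (x + (y - A x)) => //; rewrite linearD opprD addrA.
have : q * (inf D + (1 - q) * inf D) < inf D.
  have : 0 < (1 - q) * ((1 - q) * inf D) by rewrite mulr_gt0// subr_gt0.
  by nra.
move=> h1 h2; have : q * nrm (y - A x) <= q * (inf D + (1 - q) * inf D).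
  by rewrite ler_wpM2l// ltW.
by lra.
Qed.

Lemma near_identity_bound_below x : (1 - q) * nrm x <= nrm (A x).
Proof.
have := nrmD (x - A x) (A x); rewrite subrK; have := Aq x; lra.
Qed.

Lemma near_identity_bound x : nrm (A x) <= 2 * nrm x.
Proof.
have := nrmD (A x - x) x; rewrite subrK nrmB; have := Aq x.
have : 0 <= (1 - q) * nrm x by rewrite mulr_ge0 ?subr_ge0 ?nrm_ge0// ltW.
lra.
Qed.

(** The approximate solutions of [A x = y] generate a Cauchy filter, because the lower bound on [A]
    turns small residuals into small distances. Its limit is an exact solution. *)
Lemma near_identity_surjective (y : X) : exists x, A x = y.
Proof.
pose B (e : R) := [set x | nrm (y - A x) < e].
pose F := filter_from [set e : R | 0 < e] B.
have FF : ProperFilter F.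
  apply: filter_from_proper; last first.
    by move=> e /(near_identity_dense y)[x xe]; exists x.
  apply: filter_from_filter; first by exists 1 => /=.
  move=> a b a0 b0; exists (Num.min a b); first by rewrite /= lt_min a0.
  by move=> x; rewrite /B/= lt_min => /andP[].
have cF : cauchy F.
  apply/cauchy_ballP => e e0.
  have e'0 : 0 < scal_re e by rewrite -(ltr_rscal k) scal_reK ?rscal0// ltW.
  (* Two points with residuals below this bound have images within [(1 - q) * e], hence lie within
     [e] of each other. *)
  have h0 : 0 < (1 - q) * scal_re e / 2.
    by rewrite divr_gt0// mulr_gt0// subr_gt0.
  exists (B ((1 - q) * scal_re e / 2), B ((1 - q) * scal_re e / 2)).
    by split; exists ((1 - q) * scal_re e / 2).
  move=> [x z] [/= Bx Bz]; rewrite -ball_normE /=.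
  rewrite -rscal_nrm -(scal_reK (ltW e0)) ltr_rscal.
  rewrite -(@ltr_pM2l _ (1 - q)) ?subr_gt0//.
  apply: le_lt_trans (near_identity_bound_below _) _.
  rewrite linearB /= -(subrKA y) (le_lt_trans (nrmD _ _))//.
  by rewrite nrmB; move: Bx Bz; rewrite /B/=; lra.
have /cvg_ex[x Fx] : cvg F by exact: cauchy_cvg.
exists x; apply/eqP; rewrite eq_sym -subr_eq0 -nrm_eq0; apply: contraT => nz.
have d0 : 0 < nrm (y - A x) / 4.
  (* A point [z] within a quarter of the residual [r] of the limit, and with residual below [r / 4],
     would give [r < r / 4 + 2 * (r / 4)]. *)
  by rewrite divr_gt0// lt_neqAle eq_sym nz nrm_ge0.
have d0' : (0 : scal R k) < rscal (nrm (y - A x) / 4).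
  by rewrite -rscal0 ltr_rscal.
have /(@cvgrPdist_lt _ _ _ F _ id)/(_ _ d0')[/= e e0 eB] := Fx.
have /(near_identity_dense y)[z] : 0 < Num.min e (nrm (y - A x) / 4).
  by rewrite lt_min e0.
rewrite lt_min => /andP[ze zd]; have /= := eB _ ze.
rewrite -rscal_nrm ltr_rscal => xz.
have := near_identity_bound (z - x); rewrite linearB/= nrmB -nrmN opprB.
have := nrmD (y - A z) (A z - A x); rewrite subrKA.
move: xz zd; rewrite (nrmB x z) (nrmB (A z)); lra.
Qed.

End near_identity.

(** * The real Hahn-Banach theorem by minimal sublinear functionals *)

Section sublinear.
Context (R : realType) (k : scalars) (V : lmodType (scal R k)).
Implicit Types (p q : V -> R) (x y : V).

(** Homogeneity concerns nonnegative real factors only, so that a complex space is treated through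
    its real structure. *)
Definition sublinear p :=
  (forall x y, p (x + y) <= p x + p y) /\
  (forall t x, 0 <= t -> p (rscal t *: x) = t * p x).

Lemma sublinear0 p : sublinear p -> p 0 = 0.
Proof. by move=> [_ /(_ 0 0 (lexx _))]; rewrite scaler0 mul0r. Qed.

Lemma sublinear_opp p x : sublinear p -> - p (- x) <= p x.
Proof.
move=> sp; have [/(_ x (- x)) + _] := sp.
by rewrite subrr sublinear0//; lra.
Qed.

(** The reverse inequality for a factor [t > 0] is the assumed one for [t^-1]. *)
Lemma sublinear_le p :
  (forall x y, p (x + y) <= p x + p y) ->
  (forall t x, 0 < t -> p (rscal t *: x) <= t * p x) -> sublinear p.
Proof.
move=> pD pZ; split=> // t x; rewrite le_eqVlt => /predU1P[<-|t0].
  (* Subadditivity at 0 gives [0 <= p 0], and the factor [2^-1] gives [p 0 <= p 0 / 2]; hence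
     [p 0 = 0]. *)
  rewrite rscal0 scale0r mul0r; have := pD 0 0; rewrite addr0.
  have := pZ 2^-1 0; rewrite scaler0 invr_gt0 ltr0n => /(_ isT); lra.
apply/eqP; rewrite eq_le pZ//= -ler_pdivlMl//.
have := pZ t^-1 (rscal t *: x); rewrite invr_gt0 => /(_ t0).
by rewrite scalerA -rscalM mulVf ?gt_eqF// rscal1 scale1r.
Qed.

(** Serves both for infima of chains and for translates. The index may change in the two
    inequalities, and [b] keeps the infimum finite. *)
Lemma inf_sublinear (I : Type) (A : set I) (F : I -> V -> R) (b : V -> R) :
  A !=set0 -> (forall i x, A i -> b x <= F i x) ->
  (forall i j x y, A i -> A j ->
    exists2 l, A l & F l (x + y) <= F i x + F j y) ->
  (forall i t x, A i -> 0 < t ->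
    exists2 j, A j & F j (rscal t *: x) <= t * F i x) ->
  sublinear (fun x => inf [set F i x | i in A]).
Proof.
move=> [i0 Ai0] bF FD FZ; pose D x := [set F i x | i in A].
have lbD x : has_lbound (D x) by exists (b x) => _ [i Ai <-]; exact: bF.
have D0 x : D x !=set0 by exists (F i0 x), i0.
have infle x i : A i -> inf (D x) <= F i x.
  by move=> Ai; apply: ge_inf; [exact: lbD | exists i].
apply: sublinear_le => [x y|t x t0].
  rewrite -lerBlDr; apply: lb_le_inf; first exact: D0.
  move=> _ [i Ai <-].
  rewrite lerBlDr [leRHS]addrC -lerBlDr; apply: lb_le_inf; first exact: D0.
  move=> _ [j Aj <-].
  rewrite lerBlDr [leRHS]addrC; have [l Al] := FD i j x y Ai Aj.
  exact/le_trans/infle.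
rewrite mulrC -ler_pdivrMr//; apply: lb_le_inf; first exact: D0.
  move=> _ [i Ai <-].
rewrite ler_pdivrMr// mulrC; have [j Aj] := FZ i t x Ai t0.
exact/le_trans/infle.
Qed.

(** Zorn's lemma for the reversed pointwise order. A chain is bounded by its infimum, which is
    finite because everything below [p0] stays above [- p0 (- x)]. *)
Lemma minimal_sublinear p0 : sublinear p0 ->
  exists p, [/\ sublinear p, forall x, p x <= p0 x &
    forall q, sublinear q -> (forall x, q x <= p x) -> forall x, p x <= q x].
Proof.
move=> sp0; pose T := {p | sublinear p /\ forall x, p x <= p0 x}.
pose Rel (p q : T) : bool := `[< forall x, sval q x <= sval p x >].
pose t0 : T := exist _ p0 (conj sp0 (fun x => lexx _)).
have [| |A totA|p pmin] := @ZL_preorder T t0 Rel.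
- by move=> p; apply/asboolP => x.
- move=> p q r /asboolP qp /asboolP rq; apply/asboolP => x.
  exact: le_trans (qp x).
- have [[p1 Ap1]|A0] := pselect (A !=set0); last first.
    by exists t0 => p Ap; case: A0; exists p.
  pose g x := inf [set sval p x | p in A].
  have lb (p : T) x : - p0 (- x) <= sval p x.
    case: p => p [sp pp0] /=; apply: le_trans (sublinear_opp _ sp).
    by rewrite lerN2.
  have gle (p : T) x : A p -> g x <= sval p x.
    move=> Ap; apply: ge_inf; last by exists p.
    by exists (- p0 (- x)) => _ [q _ <-]; exact: lb.
  have sg : sublinear g.
    apply: (inf_sublinear (F := fun p : T => sval p)
      (b := fun x => - p0 (- x))).
    + by exists p1.
    + by move=> p x _; exact: lb.
    + move=> p q x y Ap Aq.
      have [/asboolP pq|/asboolP qp] := totA _ _ Ap Aq.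
        exists q => //; have [[qD _] _] := svalP q.
        by rewrite (le_trans (qD _ _))// lerD2r.
      exists p => //; have [[pD _] _] := svalP p.
      by rewrite (le_trans (pD _ _))// lerD2l.
    + move=> p t x Ap t0'; exists p => //; have [[_ pZ] _] := svalP p.
      by rewrite pZ// ltW.
  have gp0 x : g x <= p0 x.
    by rewrite (le_trans (gle _ x Ap1))//; have [_] := svalP p1.
  exists (exist _ g (conj sg gp0)) => p Ap; apply/asboolP => x /=.
  exact: gle.
- exists (sval p); have [sp pp0] := svalP p; split=> // q sq qp.
  have qp0 x : q x <= p0 x by rewrite (le_trans (qp x)).
  by apply/asboolP/(pmin (exist _ q (conj sq qp0))); exact/asboolP.
Qed.

(** The witness is the infimum of [p (x + t y) - t p y] over [t >= 0]. The values [t = 0] and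
    [t = 1] give the two bounds. *)
Lemma sublinear_translate p y : sublinear p ->
  exists q, [/\ sublinear q, forall x, q x <= p x &
    forall x, q x <= p (x + y) - p y].
Proof.
move=> sp; have [pD pZ] := sp.
pose F t x := p (x + rscal t *: y) - t * p y.
have lb t x : 0 <= t -> - p (- x) <= F t x.
  move=> t0; rewrite /F -pZ//; have := pD (x + rscal t *: y) (- x).
  by rewrite addrAC subrr add0r; lra.
have qF t x : 0 <= t -> inf [set F i x | i in [set t | 0 <= t]] <= F t x.
  move=> t0; apply: ge_inf; last by exists t.
  by exists (- p (- x)) => _ [s s0 <-]; exact: lb.
exists (fun x => inf [set F t x | t in [set t | 0 <= t]]); split.
- apply: (inf_sublinear (F := F) (b := fun x => - p (- x))).
  + by exists 0 => /=.
  + by move=> t x /=; exact: lb.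
  + move=> s t x z /= s0 t0; exists (s + t); first by rewrite addr_ge0.
    rewrite /F mulrDl rscalD scalerDl.
    by have := pD (x + rscal s *: y) (z + rscal t *: y); rewrite addrACA; lra.
  + move=> s t x /= s0 t0; exists (t * s); first by rewrite mulr_ge0// ltW.
    rewrite /F mulrBr -(pZ _ _ (ltW t0)) scalerDr scalerA rscalM.
    by rewrite mulrA.
- move=> x; apply: le_trans (qF 0 x (lexx _)) _.
  by rewrite /F rscal0 scale0r addr0 mul0r subr0.
- move=> x; apply: le_trans (qF 1 x ler01) _.
  by rewrite /F rscal1 scale1r mul1r.
Qed.

(* A minimal sublinear functional is superadditive, because otherwise one of
   its translates lies strictly below it. *)
Lemma real_hahn_banach p y : sublinear p ->
  exists f : V -> R,
    [/\ forall u v, f (u + v) = f u + f v,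
        forall t u, f (rscal t *: u) = t * f u,
        forall u, f u <= p u & f y = p y].
Proof.
move=> sp; have [q [sq qp qy]] := sublinear_translate y sp.
have [f [sf fq fmin]] := minimal_sublinear sq; have [fD fZ] := sf.
have fD' u v : f (u + v) = f u + f v.
  apply/eqP; rewrite eq_le fD/=.
  have [g [sg gf gv]] := sublinear_translate v sf.
  by have := le_trans (fmin _ sg gf u) (gv u); rewrite lerBrDr.
have fN u : f (- u) = - f u.
  by apply/eqP; rewrite -addr_eq0 -fD' addNr sublinear0.
exists f; split=> //.
- move=> t u; have [t0|/ltW t0] := leP 0 t; first exact: fZ.
  by rewrite -{1}[t]opprK rscalN scaleNr fN fZ ?oppr_ge0// mulNr opprK.
- by move=> u; rewrite (le_trans (fq u)).
(* The translate bound at [- y] reads [q (- y) <= - p y], which forces [p y <= f y]. *)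
- apply/eqP; rewrite eq_le (le_trans (fq y))//=.
  have := le_trans (fq (- y)) (qy (- y)); rewrite addNr sublinear0// fN.
  by rewrite sub0r lerN2.
Qed.

End sublinear.

(** * Norming functionals and the perturbation for minimum norm zero *)

Lemma nrm_sublinear (R : realType) (k : scalars)
    (V : normedModType (scal R k)) :
  sublinear (@nrm R k V).
Proof.
by split=> [x y|t x t0]; [exact: nrmD | rewrite nrmZ ger0_norm].
Qed.

Lemma scal_re_le_norm (R : realType) (k : scalars) (z : scal R k) :
  rscal (scal_re z) <= `|z|.
Proof.
case: k z => [z|[a b]] /=; first exact: ler_norm.
rewrite normc_def lecR /=; apply: le_trans (ler_norm _) _.
by rewrite -sqrtr_sqr ler_wsqrtr// lerDl sqr_ge0.
Qed.

Lemma real_norming_functional (R : realType) (k : scalars)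
    (V : normedModType (scal R k)) (x0 : V) :
  exists f : {scalar V}, scal_re (f x0) = nrm x0 /\
    forall x, scal_re (f x) <= nrm x.
Proof.
have [f [fD fZ fle fx0]] := real_hahn_banach x0 (nrm_sublinear V).
case: k V x0 f fD fZ fle fx0 => V x0 f fD fZ fle fx0.
  have lf : scalar f by move=> a u v; rewrite fD fZ.
  pose L := GRing.isLinear.Build _ _ _ _ f lf.
  by exists (HB.pack_for {scalar V} f L).
(* The complex-linear functional whose real part is the given real-linear [f]. *)
pose F (x : V) : R[i] := (f x +i* - f ('i%C *: x))%C.
have lF : scalar F.
  move=> [s t] u v.
  have E w : (s +i* t)%C *: w =
      (rscal s : scal R ComplexScalars) *: w +
      (rscal t : scal R ComplexScalars) *: ('i%C *: w).
    rewrite scalerA -scalerDl; congr (_ *: _).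
    by apply/eqP; rewrite eq_complex /=; apply/andP; split; apply/eqP; ring.
  have E' w : 'i%C *: ('i%C *: w) = - w.
    rewrite scalerA -[RHS]scaleN1r; congr (_ *: _).
    by apply/eqP; rewrite eq_complex /=; apply/andP; split; apply/eqP; ring.
  have fN w : f (- w) = - f w.
    by rewrite -scaleN1r -(rscal1 R ComplexScalars) -rscalN fZ mulN1r.
  apply/eqP; rewrite eq_complex /F /=; apply/andP; split; apply/eqP.
    by rewrite fD E fD !fZ; ring.
  rewrite scalerDr fD [in 'i%C *: (_ *: _)]scalerA mulrC -scalerA E.
  by rewrite fD !fZ E' fN; ring.
pose L := GRing.isLinear.Build _ _ _ _ F lF.
by exists (HB.pack_for {scalar V} F L).
Qed.

Lemma norming_functional (R : realType) (k : scalars)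
    (V : normedModType (scal R k)) (x0 : V) : nrm x0 = 1 ->
  exists f : {scalar V}, f x0 = 1 /\ forall x, `|f x| <= `|x|.
Proof.
move=> x01; have [f [fx0 fle]] := real_norming_functional x0.
have fnorm x : `|f x| <= `|x|.
  have [->|fx] := eqVneq (f x) 0; first by rewrite normr0.
  (* Rotating [x] by a unimodular scalar makes the value of [f] real and equal to its modulus,
     without changing the norm of [x]. *)
  have := fle ((`|f x| / f x) *: x).
  rewrite -(ler_rscal k) rscal_nrm linearZ /= divfK// scal_reK//.
  by rewrite normrZ normrM normfV normr_id divff ?normr_eq0// mul1r.
have fx01 : `|f x0| = 1.
  apply/eqP; rewrite eq_le; apply/andP; split.
    by rewrite (le_trans (fnorm _))// -rscal_nrm x01 rscal1.
  by rewrite -(rscal1 R k) -x01 -fx0 scal_re_le_norm.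
have fx0n0 : f x0 != 0 by rewrite -normr_eq0 fx01 oner_neq0.
(* Dividing by the unimodular number [f x0] preserves the norm bound and makes the value at [x0]
   exactly 1. *)
pose g x := (f x0)^-1 * f x.
have lg : scalar g.
  by move=> a u v; rewrite /g linearP mulrDr; congr (_ + _); rewrite mulrCA.
pose L := GRing.isLinear.Build _ _ _ _ g lg.
exists (HB.pack_for {scalar V} g L); split => [|x] /=.
  by rewrite /g mulVf.
by rewrite /g normrM normfV fx01 invr1 mul1r.
Qed.

Lemma annihilating_perturbation (R : realType) (k : scalars)
    (X Y : normedModType (scal R k)) (T : bounded_op X Y) (x : X) :
  nrm x = 1 ->
  exists S : bounded_op X Y, S x = 0 /\ opnorm (T \- S) <= nrm (T x).
Proof.
move=> x1; have [f [fx fle]] := norming_functional x1.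
have [C C0 TC] := bounded_op_nrm T.
have fTx z : nrm (f z *: T x) <= nrm (T x) * nrm z.
  rewrite -(ler_rscal k) rscalM !rscal_nrm normrZ mulrC.
  by rewrite ler_wpM2l.
have [|z|S SE] := @bounded_op_of_linear _ _ _ _
    (fun z => T z - f z *: T x) (C + nrm (T x)).
- move=> a u v; rewrite !linearP/= scalerDl -scalerA scalerBr.
  by rewrite opprD addrACA.
- by rewrite (le_trans (nrmD _ _))// nrmN mulrDl lerD.
exists S; split; first by rewrite SE fx scale1r subrr.
apply: opnorm_le; first by exists x.
move=> z z1; rewrite /= SE opprB addrC subrK.
by rewrite (le_trans (fTx z))// z1 mulr1.
Qed.

(** * Invertibility of a perturbed scaled inverse *)

Section inverse_perturbation.
Context (R : realType) (k : scalars) (X : completeNormedModType (scal R k)).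
Context (Z : normedModType (scal R k)) (E : {linear X -> Z}).
Context (V : bounded_op Z X).
Context (rho M d : R).
Hypotheses (rho0 : 0 < rho) (M0 : 0 <= M) (d0 : 0 <= d) (dM : d * M <= rho / 2).
Hypothesis EM : forall x, nrm (E x) <= M * nrm x.
Hypothesis E_surj : forall z, exists x, E x = z.
Hypothesis VE : forall x, nrm (V (E x) - rscal rho *: x) <= d * nrm (E x).

(** For [z = E x], the vector [V z] differs from [rho x] by at most [d] times the norm of [z]. As
    [d * M <= rho / 2], this error absorbs at most half of the lower bound, whence the factor 2. *)
Lemma perturbation_bound_below z : rho * nrm z <= 2 * M * nrm (V z).
Proof.
have [x <-] := E_surj z.
have := nrmD (rscal rho *: x - V (E x)) (V (E x)).
rewrite subrK nrmZ gtr0_norm// nrmB => h.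
have {}h : rho * nrm x <= d * nrm (E x) + nrm (V (E x)).
  by rewrite (le_trans h)// lerD2r.
have h1 : M * (rho * nrm x) <= M * (d * nrm (E x) + nrm (V (E x))).
  by rewrite ler_wpM2l.
have h2 : rho * nrm (E x) <= rho * (M * nrm x) by rewrite ler_wpM2l// ltW.
have h3 : d * M * nrm (E x) <= rho / 2 * nrm (E x).
  by rewrite ler_wpM2r ?nrm_ge0.
lra.
Qed.

(** The operator [rho^-1 V E] on [X] is within [2^-1] of the identity, hence onto. *)
Lemma perturbation_surjective x : exists z, V z = x.
Proof.
pose A (x : X) := rscal rho^-1 *: V (E x).
have lA : linear A.
  move=> a u v; rewrite /A (linearP E) (linearP V) scalerDr !scalerA.
  by congr (_ *: _ + _); rewrite mulrC.
pose L := GRing.isLinear.Build _ _ _ _ A lA.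
pose A' : {linear X -> X} := HB.pack_for {linear X -> X} A L.
have Aq u : nrm (u - A' u) <= 2^-1 * nrm u.
  have -> : u - A' u = rscal rho^-1 *: (rscal rho *: u - V (E u)).
    by rewrite scalerBr scalerA -rscalM mulVf ?gt_eqF// rscal1 scale1r.
  rewrite nrmZ gtr0_norm ?invr_gt0// nrmB ler_pdivrMl//.
  rewrite (le_trans (VE u))//.
  have h1 : d * nrm (E u) <= d * (M * nrm u) by rewrite ler_wpM2l.
  have h2 : d * M * nrm u <= rho / 2 * nrm u by rewrite ler_wpM2r ?nrm_ge0.
  lra.
have [| |u Au] := near_identity_surjective _ _ Aq x.
- by rewrite invr_ge0.
- by rewrite invf_lt1// ltr1n.
exists (rscal rho^-1 *: E u); rewrite linearZ; exact: Au.
Qed.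

Lemma perturbation_inverse :
  exists P : {linear X -> Z}, [/\ cancel P V, cancel V P &
    forall x, rho * nrm (P x) <= 2 * M * nrm x].
Proof.
pose P x := projT1 (cid (perturbation_surjective x)).
have PK : cancel P V by move=> x; rewrite /P; case: cid.
have V_inj : injective V.
  move=> z w zw; apply/eqP; rewrite -subr_eq0 -nrm_eq0.
  have := perturbation_bound_below (z - w).
  rewrite linearB/= zw subrr nrm0 mulr0 pmulr_rle0// => h.
  by rewrite eq_le h nrm_ge0.
have lP : linear P by move=> a u v; apply: V_inj; rewrite linearP/= !PK.
pose L := GRing.isLinear.Build _ _ _ _ P lP.
exists (HB.pack_for {linear X -> Z} P L); split => //=.
  by move=> z; apply: V_inj; rewrite PK.
by move=> x; rewrite -[in leRHS](PK x) perturbation_bound_below.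
Qed.

End inverse_perturbation.

(** * A monomorphism and the scaled inverse on its range *)

Section range_maps.
Context (R : realType) (k : scalars) (X : completeNormedModType (scal R k)).
Context (Y : normedModType (scal R k)) (T : monomorphism X Y).

Lemma monomorphism_inj : injective T.
Proof.
move=> u v uv; apply/eqP; rewrite -subr_eq0 -nrm_eq0.
have := nrm_ge_minnorm T (u - v).
rewrite linearB/= uv subrr nrm0 pmulr_rle0 ?mono_gt0// => h.
by rewrite eq_le h nrm_ge0.
Qed.

Lemma range_corestriction :
  exists E : {linear X -> range_space T},
    (forall x, range_val (E x) = T x) /\ (forall z, exists x, E x = z).
Proof.
have Tr x : T x \in range_pred T by rewrite unfold_in inE; exists x.
pose E x := RangeSpace (Tr x).
have lE : linear E by move=> a u v; apply: val_inj; rewrite /= linearP.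
pose L := GRing.isLinear.Build _ _ _ _ E lE.
exists (HB.pack_for {linear X -> range_space T} E L); split => // z.
have : range_val z \in range_pred T by case: z.
by rewrite unfold_in inE => -[x _ xz]; exists x; exact: val_inj.
Qed.

(** The operator is [U = m(T) T^-1], of norm at most 1 by definition of [m(T)]. A smaller norm would
    raise the lower bound of [T] above [m(T)]. *)
Lemma scaled_inverse : sphere X !=set0 ->
  exists U : bounded_op (range_space T) X,
    opnorm U = 1 /\ forall z, T (U z) = rscal (minnorm T) *: range_val z.
Proof.
move=> [x0 x01].
have [E [ET Es]] := range_corestriction.
pose P z := projT1 (cid (Es z)).
have PK : cancel P E by move=> z; rewrite /P; case: cid.
have TP z : T (P z) = range_val z by rewrite -ET PK.
have rho0 := mono_gt0 T.
have lU : linear (fun z => rscal (minnorm T) *: P z).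
  move=> a u v; apply: monomorphism_inj; rewrite linearP/= !linearZ/= !TP.
  by rewrite scalerDr !scalerA mulrC.
have Ule z : nrm (rscal (minnorm T) *: P z) <= 1 * nrm z.
  by rewrite nrmZ gtr0_norm// mul1r (le_trans (nrm_ge_minnorm _ _))// TP.
have [U UE] := bounded_op_of_linear lU Ule.
have nT0 : 0 < nrm (T x0).
  by rewrite (lt_le_trans rho0)// minnorm_le.
have Ub x : minnorm T * nrm x <= opnorm U * nrm (T x).
  have := nrm_bounded_op_le U (E x); rewrite UE nrmZ gtr0_norm//.
  rewrite {2}/nrm range_space_normE ET.
  suff -> : P (E x) = x by [].
  by apply: monomorphism_inj; rewrite TP ET.
exists U; split; last by move=> z; rewrite UE linearZ/= TP.
apply/eqP; rewrite eq_le; apply/andP; split.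
  apply: opnorm_le.
    exists (rscal (nrm (E x0))^-1 *: E x0); apply: normed_sphere.
    by rewrite -nrm_gt0 /nrm range_space_normE ET.
  by move=> z z1; rewrite UE (le_trans (Ule z))// z1 mulr1.
have U0 : 0 < opnorm U.
  have := Ub x0; rewrite x01 mulr1 => /(lt_le_trans rho0).
  by rewrite pmulr_lgt0.
have : minnorm T / opnorm U <= minnorm T.
  apply: le_minnorm; first by exists x0.
  by move=> x x1; rewrite ler_pdivrMr// mulrC -[minnorm T]mulr1 -x1 Ub.
by rewrite ler_pdivrMr// -{1}[minnorm T]mulr1 ler_pM2l.
Qed.

End range_maps.

(** * Attaining the minimum norm of a monomorphism *)

Section minimum_norm_attainment.
Context (R : realType) (k : scalars) (X Y : completeNormedModType (scal R k)).
Context (T : monomorphism X Y) (eta : R -> R).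
Hypothesis TBPB : BPBp (range_space T) X eta.

(** Here [d] is the accuracy asked of the Bishop-Phelps-Bollobás property and [h] the defect of [x].
    The operator estimate comes from [T - S = T (V - U) V^-1], where [V^-1] is bounded by
    [2 * M / rho]. *)
Lemma mono_minimum_attaining (M d h : R) (x : X) :
  nrm x = 1 -> opnorm T <= M -> 0 < d < 1 -> d * M <= minnorm T / 2 ->
  0 < h <= eta d -> nrm (T x) < minnorm T * (1 + h) ->
  exists (S : bounded_op X Y) (y : X),
    [/\ nrm y = 1, nrm (S y) = minnorm S, minnorm S = minnorm T,
        opnorm (T \- S) <= M * (d * (2 * M)) / minnorm T &
        nrm (x - y) <= h + (d + d)].
Proof.
move=> x1 TM d01 dM /andP[h0 hd] Txh; have /andP[d0 d1] := d01.
have rho0 := mono_gt0 T; set rho := minnorm T in dM Txh rho0 *.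
have [U [U1 TU]] : exists U : bounded_op (range_space T) X,
    opnorm U = 1 /\ forall z, T (U z) = rscal (minnorm T) *: range_val z.
  by apply: scaled_inverse; exists x.
have [E [ET Es]] := range_corestriction T.
have UE u : U (E u) = rscal rho *: u.
  by apply: (@monomorphism_inj _ _ _ _ T); rewrite TU ET linearZ.
have nT u : nrm (T u) <= M * nrm u.
  by rewrite (le_trans (nrm_bounded_op_le _ _))// ler_wpM2r ?nrm_ge0.
have nE u : nrm (E u) = nrm (T u) by rewrite /nrm range_space_normE ET.
have Tx_ge : rho <= nrm (T x) by exact: minnorm_le.
have Tx0 : 0 < nrm (T x) by exact: lt_le_trans Tx_ge.
have M0 : 0 <= M.
  by have := nT x; rewrite x1 mulr1 => /(lt_le_trans Tx0)/ltW.
pose z := rscal (nrm (T x))^-1 *: E x.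
have z1 : nrm z = 1.
  by rewrite /z -nE normed_sphere// -nrm_gt0 nE.
have Uz : U z = rscal (rho / nrm (T x)) *: x.
  by rewrite /z linearZ/= UE scalerA -rscalM mulrC.
have nUz : nrm (U z) > 1 - eta d.
  (* The norm of [U z] is [rho / nrm (T x)], which exceeds [1 / (1 + h)] and so [1 - h]. The case
     [h >= 1] is separate because the argument multiplies by [1 - h]. *)
  rewrite Uz nrmZ x1 mulr1 gtr0_norm ?divr_gt0// ltr_pdivlMr//.
  have e1 : (1 - eta d) * nrm (T x) <= (1 - h) * nrm (T x).
    by rewrite ler_wpM2r ?nrm_ge0// lerB.
  apply: le_lt_trans e1 _.
  have [h1|h1] := leP 1 h.
    by apply: le_lt_trans rho0; rewrite mulr_le0_ge0 ?nrm_ge0// subr_le0.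
  have : (1 - h) * nrm (T x) < (1 - h) * (rho * (1 + h)).
    by rewrite ltr_pM2l// subr_gt0.
  have : 0 < rho * (h * h) by rewrite !mulr_gt0.
  by lra.
have [_ /(_ U z U1)] := TBPB d01.
rewrite inE => /(_ z1 nUz) [V [w [V1 /set_mem w1 Vw VU zw]]].
have VUd v : nrm (V v - U v) <= d * nrm v.
  by apply: nrm_bounded_op_sub_le; exact: ltW.
have [P [PK VK nP]] : exists P : {linear X -> range_space T},
    [/\ cancel P V, cancel V P & forall u, rho * nrm (P u) <= 2 * M * nrm u].
  apply: (@perturbation_inverse _ _ _ _ E V rho M d) => //.
  - exact: ltW.
  - by move=> u; rewrite nE nT.
  - by move=> u; rewrite -UE; exact: VUd.
have lS : linear (fun u => rscal rho *: range_val (P u)).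
  by move=> a u v; rewrite linearP /= scalerDr !scalerA mulrC.
have nS u : nrm (rscal rho *: range_val (P u)) <= 2 * M * nrm u.
  by rewrite nrmZ gtr0_norm//; exact: nP.
have [S SE] := bounded_op_of_linear lS nS.
have nSP u : nrm (S u) = rho * nrm (P u) by rewrite SE nrmZ gtr0_norm.
have S_ge u : nrm u = 1 -> rho <= nrm (S u).
  (* Since [V] has norm 1 and [V (P u) = u], the norm of [P u] is at least 1. *)
  move=> u1; rewrite nSP ler_peMr ?(ltW rho0)// -u1 -{1}(PK u).
  by rewrite (le_trans (nrm_bounded_op_le V _))// V1 mul1r.
have Sy : nrm (S (V w)) = rho by rewrite nSP VK w1 mulr1.
have mS : minnorm S = rho.
  apply/eqP; rewrite eq_le -{1}Sy minnorm_le//=.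
  by apply: le_minnorm => //; exists x.
exists S, (V w); split; rewrite ?Sy ?mS//.
- apply: opnorm_le; first by exists x.
  move=> u u1 /=; rewrite SE -{1}(PK u).
  have -> : T (V (P u)) - rscal rho *: range_val (P u) = T (V (P u) - U (P u)).
    by rewrite linearB/= TU.
  rewrite (le_trans (nT _))// -mulrA ler_wpM2l//.
  rewrite (le_trans (VUd _))// -mulrA ler_wpM2l ?(ltW d0)//.
  by rewrite ler_pdivlMr// mulrC (le_trans (nP _))// u1 mulr1.
(* As [x] is the multiple [nrm (T x) / rho] of [U z], the three terms are bounded by [h], [d] and
   [d]. *)
- have -> : x - V w = rscal (nrm (T x) / rho - 1) *: U z +
      ((U z - U w) + (U w - V w)).
    rewrite subrKA addrA; congr (_ - _).
    rewrite rscalD rscalN rscal1 scalerBl scale1r subrK Uz scalerA -rscalM.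
    by rewrite mulrA divfK ?gt_eqF// divff ?gt_eqF// rscal1 scale1r.
  have U_le v : nrm (U v) <= nrm v.
    by rewrite (le_trans (nrm_bounded_op_le _ _))// U1 mul1r.
  rewrite (le_trans (nrmD _ _))// lerD//.
    have a0 : 0 <= nrm (T x) / rho - 1.
      by rewrite subr_ge0 ler_pdivlMr// mul1r.
    rewrite nrmZ ger0_norm// (@le_trans _ _ (nrm (T x) / rho - 1))//.
      by rewrite ler_piMr// (le_trans (U_le _))// z1.
    by rewrite lerBlDl ler_pdivrMr// mulrC ltW.
  rewrite (le_trans (nrmD _ _))// lerD//.
    by rewrite -linearB (le_trans (U_le _))// ltW.
  by rewrite nrmB (le_trans (VUd _))// w1 mulr1.
Qed.

End minimum_norm_attainment.

(** * The modulus for the minimum norm *)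

Section modulus.
Context (R : realType) (eta : R -> R).
Hypothesis eta01 : forall e, 0 < e < 1 -> 0 < eta e < 1.

(* The bounds rho / (2 M) and e rho / (4 M^2) make the perturbation invertible
   and keep the distance between the inverses below e. *)
Definition inverse_modulus (e M rho : R) : R :=
  Num.min (Num.min (e / 4) 2^-1)
    (Num.min (rho / (2 * M)) (e * rho / (4 * M ^+ 2))).

(** The term [e / 4] forces convergence to 0 with [e]. The other term keeps the value below 1 when
    [e] is large. *)
Definition minnorm_modulus (e M rho : R) : R :=
  Num.min (e / 4) (if rho == 0 then 2^-1 else eta (inverse_modulus e M rho)).

(** The cap [2^-1] keeps [d] in the domain of [eta], and [d <= e / 4] leaves room for
    [h + (d + d) < e] when [h <= e / 4]. *)
Lemma inverse_modulusP e M rho : 0 < e -> 0 < rho -> 0 < M ->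
  let d := inverse_modulus e M rho in
  [/\ 0 < d < 1, d <= e / 4, d * M <= rho / 2 &
    M * (d * (2 * M)) / rho <= e / 2].
Proof.
move=> e0 r0 M0 d.
have M2 : 0 < M ^+ 2 by rewrite exprn_gt0.
have d0 : 0 < d.
  by rewrite /d /inverse_modulus !lt_min invr_gt0 ltr0n !divr_gt0 ?mulr_gt0.
have dd : d <= d by [].
rewrite {2}/d /inverse_modulus !le_min !ler_pdivlMr ?mulr_gt0// in dd.
have /andP[/andP[d1 d2] /andP[d3 d4]] := dd.
split; first by rewrite d0; lra.
- lra.
- lra.
- by rewrite ler_pdivrMr//; move: d4; rewrite expr2; lra.
Qed.

Lemma minnorm_modulus_gt0_lt1 e M rho : 0 < e -> 0 <= rho <= M ->
  0 < minnorm_modulus e M rho < 1.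
Proof.
move=> e0 /andP[r0 rM]; rewrite /minnorm_modulus lt_min gt_min.
have [r1|r1] := eqVneq rho 0.
  by rewrite divr_gt0// invr_gt0 ltr0n invf_lt1// ltr1n orbT.
have {}r0 : 0 < rho by rewrite lt_neqAle eq_sym r1.
have [/eta01/andP[-> ->] _ _ _] := inverse_modulusP e0 r0 (lt_le_trans r0 rM).
by rewrite divr_gt0// orbT.
Qed.

Lemma minnorm_modulus_cvg M rho : 0 <= rho <= M ->
  minnorm_modulus e M rho @[e --> 0^'+] --> 0.
Proof.
move=> rM; apply: (@squeeze_cvgr _ _ _ _ (fun=> 0) id).
- near=> e; have e0 : 0 < e by near: e; exact: nbhs_right_gt.
  have /andP[/ltW-> _] := minnorm_modulus_gt0_lt1 e0 rM.
  by rewrite /minnorm_modulus ge_min; apply/orP; left; lra.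
- exact: cvg_cst.
- exact/cvg_at_right_filter/cvg_id.
Unshelve. all: by end_near. Qed.

End modulus.

(** * Assembly of the cases [rho = 0] and [rho > 0] *)

Theorem theorem3p17 (R : realType) (k : scalars)
  (X Y : completeNormedModType (scal R k))
  (X_neq0 : exists x : X, x != 0) (Y_neq0 : exists y : Y, y != 0)
  (range_BPBp : exists eta : R -> R,
    (forall eps : R, 0 < eps < 1 -> 0 < eta eps < 1) /\
    forall T : monomorphism X Y, BPBp (range_space T) X eta) :
  bounded_BPBp_m X Y.
Proof.
have [eta [eta01 TBPB]] := range_BPBp.
exists (minnorm_modulus eta) => M rho rM; split.
  exact: minnorm_modulus_cvg.
move=> e e0; split; first exact: minnorm_modulus_gt0_lt1.
have /andP[h0 _] := minnorm_modulus_gt0_lt1 eta01 e0 rM.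
have he : minnorm_modulus eta e M rho <= e / 4 by rewrite ge_min lexx.
move=> T x /set_mem x1 TM mT Tx_pos Tx_zero.
have /andP[r0 {}rM] := rM.
have [r1|r1] := eqVneq rho 0.
  (* The point [x] itself is kept: [S x = 0] makes it a minimiser with [m(S) = 0]. *)
  have [S [Sx TS]] := annihilating_perturbation T x1.
  have mS : minnorm S = 0.
    apply/eqP; rewrite eq_le; apply/andP; split.
      by rewrite -(nrm0 Y) -Sx minnorm_le.
    by apply: le_minnorm => [|u _]; [exists x | exact: nrm_ge0].
  exists S, x; rewrite subrr Sx !nrm0 mS mT; split=> //; first exact: mem_set.
  by rewrite (le_lt_trans TS)// (lt_trans (Tx_zero r1))//; lra.
have {}r0 : 0 < rho by rewrite lt_neqAle eq_sym r1.
have [d01 de dM de2] := inverse_modulusP e0 r0 (lt_le_trans r0 rM).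
have m0 : 0 < minnorm T by rewrite mT.
(* A positive minimum norm makes [T] a monomorphism, so the hypothesis applies to its range. *)
pose T' := Monomorphism m0.
have [||S [y [y1 Sy mS TS xy]]] := mono_minimum_attaining (T := T')
    (TBPB T') x1 TM d01 _ _ (Tx_pos r0).
- by rewrite /= mT.
- by rewrite h0 /minnorm_modulus (negbTE r1) ge_min lexx orbT.
exists S, y; split => //; first exact: mem_set.
- by rewrite (le_lt_trans TS)//= mT (le_lt_trans de2)//; lra.
- by rewrite (le_lt_trans xy)//; lra.
Qed.
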